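(* Let $\theta\in\{1,2\}$ and let $a,b\in\mathcal{R}^{(2)}$ with $a\stackrel{\theta}{<}b$. (i) Let $f:[a,b]_\theta\to\mathcal{R}^{(2)}$ be a function such that the real-valued functions $f_{Re}$ and $f_{Ze}$ are continuous on the rectangle $[a,b]_\theta\subseteq\mathcal{R}^2$ (which is $[Re\,a,Re\,b]\times[Ze\,a,Ze\,b]$ if $\theta=1$ and $[Re\,a,Re\,b]\times[Ze\,b,Ze\,a]$ if $\theta=2$). Then the function $F:[a,b]_\theta\to\mathcal{R}^{(2)}$ defined by $F(x):=\int_a^x f(t)\,d_\theta t$ for $x\in[a,b]_\theta$ is type $\theta$ differentiable at each $c\in[a,b]_\theta$, and $F'_\theta(c)=f(c)$. (ii) If $f:[a,b]_\theta\to\mathcal{R}^{(2)}$ is differentiable on $[a,b]_\theta$ and the derivative $f'$ of $f$ is type $\theta$ integrable on $[a,b]_\theta$, then $$\int_a^b f'(x)\,d_\theta x=f(b)-f(a).$$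
   Context: Dual real numbers: $\mathcal{R}^{(2)}$ is the real vector space $\mathcal{R}^2$ (with $\mathcal{R}$ the field of real numbers) with the multiplication $(x_1,x_2)\cdot(y_1,y_2)=(x_1y_1,\,x_1y_2+x_2y_1)$. Write $1=(1,0)$, $1^{\#}=(0,1)$, so $x=(x_1,x_2)=x_1+x_2\,1^{\#}$, and put $Re\,x:=x_1$, $Ze\,x:=x_2$. The norm is $\|x\|:=\sqrt{2(Re\,x)^2+(Ze\,x)^2}$. Orders: $x\stackrel{1}{>}y$ (equivalently $y\stackrel{1}{<}x$) means either ($Re\,x>Re\,y$ and $Ze\,x\ge Ze\,y$) or ($Re\,x=Re\,y$ and $Ze\,x>Ze\,y$). $x\stackrel{2}{>}y$ (equivalently $y\stackrel{2}{<}x$) means either ($Re\,x>Re\,y$ and $Ze\,y\ge Ze\,x$) or ($Re\,x=Re\,y$ and $Ze\,y>Ze\,x$). $x\stackrel{\theta}{\ge}y$ (equivalently $y\stackrel{\theta}{\le}x$) means $x\stackrel{\theta}{>}y$ or $x=y$. For $a\stackrel{\theta}{<}b$, $[a,b]_\theta:=\{x\in\mathcal{R}^{(2)} : a\stackrel{\theta}{\le}x\stackrel{\theta}{\le}b\}$. Components: a function $f:S\to\mathcal{R}^{(2)}$, $S\subseteq\mathcal{R}^{(2)}$, is written $f=f_{Re}+f_{Ze}\,1^{\#}$ with $f_{Re},f_{Ze}$ real-valued; $f$ is bounded if both $f_{Re}$ and $f_{Ze}$ are bounded. Integral: a partition $P$ of $[a,b]_\theta$ is a finite set of points $a=x^{(0)}\stackrel{\theta}{<}x^{(1)}\stackrel{\theta}{<}\dots\stackrel{\theta}{<}x^{(n)}=b$.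 Let $f:[a,b]_\theta\to\mathcal{R}^{(2)}$ be bounded, $\Delta x^{(i)}:=x^{(i)}-x^{(i-1)}$, and for $\clubsuit\in\{Re,Ze\}$ let $\sup_i f_\clubsuit$ and $\inf_i f_\clubsuit$ be the supremum and infimum of $f_\clubsuit$ over $[x^{(i-1)},x^{(i)}]_\theta$. Define (products in $\mathcal{R}^{(2)}$) $$U_1(P,f)=\sum_{i=1}^n(\sup\nolimits_i f_{Re}+1^{\#}\sup\nolimits_i f_{Ze})\Delta x^{(i)},\quad U_2(P,f)=\sum_{i=1}^n(\sup\nolimits_i f_{Re}+1^{\#}\inf\nolimits_i f_{Ze})\Delta x^{(i)},$$ $$L_1(P,f)=\sum_{i=1}^n(\inf\nolimits_i f_{Re}+1^{\#}\inf\nolimits_i f_{Ze})\Delta x^{(i)},\quad L_2(P,f)=\sum_{i=1}^n(\inf\nolimits_i f_{Re}+1^{\#}\sup\nolimits_i f_{Ze})\Delta x^{(i)}.$$ With $P$ ranging over all partitions of $[a,b]_\theta$, the type $\theta$ lower and upper integrals are $$\underline{\int_a^b}f\,d_1x=\sup_P Re\,L_1(P,f)+1^{\#}\sup_P Ze\,L_1(P,f),\quad \underline{\int_a^b}f\,d_2x=\sup_P Re\,L_2(P,f)+1^{\#}\inf_P Ze\,L_2(P,f),$$ $$\overline{\int_a^b}f\,d_1x=\inf_P Re\,U_1(P,f)+1^{\#}\inf_P Ze\,U_1(P,f),\quad \overline{\int_a^b}f\,d_2x=\inf_P Re\,U_2(P,f)+1^{\#}\sup_P Ze\,U_2(P,f).$$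 $f$ is type $\theta$ integrable on $[a,b]_\theta$ if its type $\theta$ lower and upper integrals are equal; the common value is $\int_a^b f(x)\,d_\theta x$. By convention $\int_a^a f\,d_\theta x=0$. Differentiability: for $\delta>0$ let $N(c;\delta)=\{x:\|x-c\|<\delta\}$, $N^*(c;\delta)=N(c;\delta)\setminus\{c\}$, and $N^*_\theta(c;\delta)=\{x\in N^*(c;\delta) : x\stackrel{\theta}{\ge}c\text{ or }x\stackrel{\theta}{\le}c\}$. A function $g:[a,b]_\theta\to\mathcal{R}^{(2)}$ is type $\theta$ differentiable at $c\in[a,b]_\theta$ with type $\theta$ derivative $g'_\theta(c)=L\in\mathcal{R}^{(2)}$ if for every real $\epsilon>0$ there is a real $\delta>0$ such that $\frac{\|g(x)-g(c)-L(x-c)\|}{\|x-c\|}<\epsilon$ for all $x\in N^*_\theta(c;\delta)\cap[a,b]_\theta$. It is differentiable at $c$ with derivative $g'(c)=L$ if the same holds with $N^*(c;\delta)\cap[a,b]_\theta$ in place of $N^*_\theta(c;\delta)\cap[a,b]_\theta$, and differentiable on $[a,b]_\theta$ if it is differentiable at every $c\in[a,b]_\theta$.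
   Formalization: In (i), f is additionally assumed type θ integrable on [a,b]_θ: continuity of f_Re and f_Ze does not imply it (θ=1, f(x)=(Ze x,0) on [(0,0),(1,1)]), so F(b) may not exist; integrability on each [a,x]_θ is then proved. *)

(* Defs.v *)
From mathcomp Require Import all_boot all_order all_algebra.
From mathcomp Require Import all_classical all_reals all_analysis.
Import Order.TTheory GRing.Theory Num.Theory.
Import numFieldNormedType.Exports.
Set Implicit Arguments.
Unset Strict Implicit.
Unset Printing Implicit Defensive.
Local Open Scope classical_set_scope.
Local Open Scope ring_scope.

(* A dual real number x_1 + x_2 1^# is the
   pair (x_1, x_2) : R * R, so Re x = x.1 and Ze x = x.2.  Addition and topology
   are those of the product R * R, but the library's ring product on R * R is
   componentwise, hence the separate dmul. *)

Inductive dual_type := Type1 | Type2.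

Section DualReal.
Variable R : realType.
Implicit Types (th : dual_type) (x y a b c L : R * R) (f g : R * R -> R * R).
Implicit Types (s : seq (R * R)) (A : set (R * R)) (delta : R).

Definition dmul x y : R * R := (x.1 * y.1, x.1 * y.2 + x.2 * y.1).

Definition dnorm x : R := Num.sqrt (2 * x.1 ^+ 2 + x.2 ^+ 2).

Definition dlt th x y : bool :=
  match th with
  | Type1 => (x.1 < y.1) && (x.2 <= y.2) || (x.1 == y.1) && (x.2 < y.2)
  | Type2 => (x.1 < y.1) && (y.2 <= x.2) || (x.1 == y.1) && (y.2 < x.2)
  end.

Definition dle th x y : bool := dlt th x y || (x == y).

Definition ditv th a b : set (R * R) := [set x | dle th a x && dle th x b].

(* The partition a = x^(0) < x^(1) < ... < x^(n) = b is encoded by the list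
   [:: x^(1); ...; x^(n)]. *)
Definition dpartition th a b : set (seq (R * R)) :=
  [set s | path (dlt th) a s && (last a s == b)].

Definition sup_Re th f x y : R := sup [set (f t).1 | t in ditv th x y].
Definition sup_Ze th f x y : R := sup [set (f t).2 | t in ditv th x y].
Definition inf_Re th f x y : R := inf [set (f t).1 | t in ditv th x y].
Definition inf_Ze th f x y : R := inf [set (f t).2 | t in ditv th x y].

(* zip (a :: s) s lists the pairs (x^(i-1), x^(i)). *)
Definition upper_sum th f a s : R * R :=
  \sum_(p <- zip (a :: s) s)
    dmul (sup_Re th f p.1 p.2,
          match th with
          | Type1 => sup_Ze th f p.1 p.2
          | Type2 => inf_Ze th f p.1 p.2
          end) (p.2 - p.1).

Definition lower_sum th f a s : R * R :=
  \sum_(p <- zip (a :: s) s)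
    dmul (inf_Re th f p.1 p.2,
          match th with
          | Type1 => inf_Ze th f p.1 p.2
          | Type2 => sup_Ze th f p.1 p.2
          end) (p.2 - p.1).

Definition lower_integral th f a b : R * R :=
  (sup [set (lower_sum th f a s).1 | s in dpartition th a b],
   match th with
   | Type1 => sup [set (lower_sum th f a s).2 | s in dpartition th a b]
   | Type2 => inf [set (lower_sum th f a s).2 | s in dpartition th a b]
   end).

Definition upper_integral th f a b : R * R :=
  (inf [set (upper_sum th f a s).1 | s in dpartition th a b],
   match th with
   | Type1 => inf [set (upper_sum th f a s).2 | s in dpartition th a b]
   | Type2 => sup [set (upper_sum th f a s).2 | s in dpartition th a b]
   end).

Definition dbounded f A : Prop :=
  [bounded (f x).1 | x in A] /\ [bounded (f x).2 | x in A].

(* Continuity of f does not imply integrability: partitions are chains, and two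
   chains from a to b need not have a common refinement.  For instance, on
   [(0,0), (1,1)] with th = Type1 and f x = (x.2, 0), the chain through (0,1)
   makes the real part of the lower integral at least 1, and the chain through
   (1,0) makes that of the upper integral at most 0. *)
Definition dintegrable th f a b : Prop :=
  dbounded f (ditv th a b) /\ lower_integral th f a b = upper_integral th f a b.

(* Meaningful when a = b or f is integrable. *)
Definition dintegral th f a b : R * R :=
  if a == b then 0 else lower_integral th f a b.

Definition dnbhs c delta : set (R * R) := [set x | dnorm (x - c) < delta].

Definition dnbhs_punct c delta : set (R * R) := dnbhs c delta `\ c.

Definition dnbhs_typed th c delta : set (R * R) :=
  dnbhs_punct c delta `&` [set x | dle th c x || dle th x c].

Definition is_tderiv th A g c L : Prop :=
  forall eps : R, 0 < eps -> exists2 delta : R, 0 < delta &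
    forall x, (dnbhs_typed th c delta `&` A) x ->
      dnorm (g x - g c - dmul L (x - c)) / dnorm (x - c) < eps.

(* L is unique unless A lies on a line Re x = Re c, where Ze L is arbitrary. *)
Definition is_dderiv A g c L : Prop :=
  forall eps : R, 0 < eps -> exists2 delta : R, 0 < delta &
    forall x, (dnbhs_punct c delta `&` A) x ->
      dnorm (g x - g c - dmul L (x - c)) / dnorm (x - c) < eps.

End DualReal.

(* Main.v *)
Require Import Defs.
From mathcomp Require Import all_boot all_order all_algebra.
From mathcomp Require Import all_classical all_reals all_analysis.
From mathcomp Require Import ring lra.
Import Order.TTheory GRing.Theory Num.Theory.
Import numFieldNormedType.Exports.
Set Implicit Arguments.
Unset Strict Implicit.
Unset Printing Implicit Defensive.
Local Open Scope classical_set_scope.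
Local Open Scope ring_scope.

(* Up to the sign of Ze, the two components of a type theta integral are the
   Darboux integrals, along chains of the product order, of the 1-forms
   f_Re dRe and f_Re dZe + f_Ze dRe; integrability says that all lower sums lie
   below all upper sums, with a common separating value.
   (i) For continuous f every chain has refinements with arbitrarily close lower
   and upper sums.  Prolonging two chains from a to x by one fine chain from x
   to b makes f integrable on [a, x], and appending the single cell [c, x] to
   chains from a to c bounds F(x) - F(c) by the extrema of f on [c, x].
   (ii) The mean value theorem on the segment joining the ends of a cell puts
   the increment of f between the lower and upper terms of f' on that cell, so
   f(b) - f(a) separates the lower sums from the upper sums. *)

(** * Uniform continuity on compact sets and a mean value theorem on [0, 1] *)

Lemma compact_uniform_continuous {R : realType} {T : pseudoMetricType R}
    (A : set T) (f : T -> R) :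
  compact A -> {within A, continuous f} ->
  forall e : R, 0 < e -> exists2 d : R, 0 < d &
    forall p q, A p -> A q -> ball p d q -> `|f p - f q| < e.
Proof.
move=> /compact_near_coveringP/near_covering_withinP cA.
move=> /subspace_continuousP fc e e0.
(* In the near-covering form of compactness, with [d] tending to 0 from the right, a radius found
   near each point becomes one radius for all of [A]; this stands in for a finite subcover. *)
have /= := cA R (0^'+)
  (fun d p => forall q, A q -> ball p d q -> `|f p - f q| < e).
case => [x Ax|d /= d0 /(_ (d / 2))].
- have e20 : 0 < e / 2 by rewrite divr_gt0.
  have /cvgrPdist_lt/(_ _ e20) := fc x Ax.
  rewrite near_withinE => /nbhs_ballP[r /= r0 xr].
  have r20 : 0 < r / 2 by rewrite divr_gt0.
  exists (ball x (r / 2), [set d | d < r / 2]).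
    split => /=; first exact: nbhsx_ballx.
    exact: nbhs_right_lt.
  move=> [p d] /= [xp dr] Ap q Aq pq.
  have xp' : ball x r p by apply: le_ball xp; lra.
  have xq : ball x r q.
    rewrite (splitr r); apply: ball_triangle xp _.
    by apply: le_ball pq; exact: ltW.
  have := xr _ xp' Ap; have := xr _ xq Aq => /= h1 h2.
  rewrite (_ : f p - f q = (f x - f q) - (f x - f p)); last by ring.
  by rewrite (le_lt_trans (ler_normB _ _))// (splitr e) ltrD.
- move=> H; exists (d / 2); first by rewrite divr_gt0.
  move=> p q Ap Aq; apply: H => //=; last by rewrite divr_gt0.
  by rewrite sub0r normrN gtr0_norm; lra.
Qed.

(** Differentiability is relative to [0, 1], hence one-sided at the ends. It gives continuity up to
    the ends and a genuine derivative inside, which is all that [MVT] asks for. *)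
Lemma mean_value_unit_itv {R : realType} (f df : R -> R) :
  (forall c : R, 0 <= c <= 1 -> forall e : R, 0 < e -> exists2 d : R, 0 < d &
    forall r : R, 0 <= r <= 1 -> `|r - c| < d ->
      `|f r - f c - df c * (r - c)| <= e * `|r - c|) ->
  exists2 r : R, 0 <= r <= 1 & f 1 - f 0 = df r.
Proof.
move=> fdf.
have fc (c : R) : 0 <= c <= 1 -> f r @[r --> within `[0, 1] (nbhs c)] --> f c.
  move=> c01; apply/cvgrPdist_lt => e e0.
  have [d d0 H] := fdf c c01 1 ltr01.
  have D0 : 0 < 1 + `|df c| by rewrite ltr_pwDl.
  rewrite near_withinE; apply/nbhs_ballP.
  (* The estimate with error factor 1 gives |f r - f c| <= (1 + |df c|) |r - c|. *)
  exists (Num.min d (e / (1 + `|df c|))) => /=.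
    by rewrite lt_min d0 divr_gt0.
  move=> r /=; rewrite /ball /= lt_min distrC ltr_pdivlMr// => /andP[rd re].
  rewrite in_itv /= => r01; have := H r r01 rd; rewrite mul1r => h.
  rewrite distrC; apply: le_lt_trans re.
  rewrite mulrDr mulr1 [_ * `|df c|]mulrC -normrM.
  rewrite -{1}(subrK (df c * (r - c)) (f r - f c)).
  by rewrite (le_trans (ler_normD _ _))// lerD2r.
have cf : {within `[0, 1], continuous f}.
  by apply/subspace_continuousP => c; rewrite /= in_itv /=; exact: fc.
have [c|c + ->] := @MVT R f df 0 1 ltr01 _ cf.
  rewrite in_itv /= => /andP[c0 c1].
  suff cv : h^-1 *: ((f \o shift c) (h *: 1) - f c) @[h --> 0^'] --> df c.
    by apply: DeriveDef; [exact: cvgP cv|exact: cvg_lim cv].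
  apply/cvgrPdist_le => e e0.
  have [|d d0 H] := fdf c _ e e0; first by rewrite !ltW.
  rewrite near_withinE; apply/nbhs_ballP.
  (* The bounds [c] and [1 - c] keep [h + c] inside [0, 1], where the hypothesis applies. *)
  exists (Num.min d (Num.min c (1 - c))) => /=.
    by rewrite !lt_min d0 c0 subr_gt0.
  move=> h; rewrite /ball /= sub0r normrN !lt_min => /and3P[hd hc h1] hN0.
  rewrite /GRing.scale /= mulr1.
  have hr : 0 <= h + c <= 1.
    move: hc h1; rewrite !ltr_norml => /andP[? ?] /andP[? ?]; lra.
  have := H _ hr; rewrite addrK => /(_ hd).
  have h0 : 0 < `|h| by rewrite normr_gt0.
  rewrite -ler_pdivrMr// -normfV -normrM distrC; congr (`|_| <= _).
  by field.
rewrite in_itv /= => /andP[c0 c1]; exists c; first by rewrite !ltW.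
by rewrite subr0 mulr1.
Qed.

(** * The two orders as a product order, and sums along chains *)

Section Chains.
Variables (R : realType) (th : dual_type).
Implicit Types (x y a b c u v w : R * R) (s t : seq (R * R)).
Implicit Types (phi psi : R * R -> R * R -> R) (g h G : R * R -> R).

(* Multiplying Ze by this sign turns the type 2 order into the product order,
   which lets both types be treated at once. *)
Definition zsgn : R := if th is Type1 then 1 else -1.

Definition ozc x : R := zsgn * x.2.

Lemma normr_zsgnM (r : R) : `|zsgn * r| = `|r|.
Proof. by rewrite /zsgn; case: th; rewrite ?mul1r// mulN1r normrN. Qed.

(** The two cases of [dlt] together with equality exhaust the product order in the coordinates [x.1]
    and [ozc x], for both types. *)
Lemma dleE x y : dle th x y = (x.1 <= y.1) && (ozc x <= ozc y).
Proof.
case: x y => [x1 x2] [y1 y2]; rewrite /dle /dlt /ozc /zsgn /= xpair_eqE.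
case: th; rewrite ?mul1r ?mulN1r ?lerN2; case: ltgtP => //= _;
  by case: ltgtP => //.
Qed.

Lemma dltE x y : dlt th x y = dle th x y && (x != y).
Proof.
rewrite /dle; have [->|xy] := eqVneq x y; last by rewrite orbF andbT.
by rewrite andbF /dlt !ltxx eqxx; case: th.
Qed.

Lemma dltW x y : dlt th x y -> dle th x y.
Proof. by rewrite /dle => ->. Qed.

Lemma dlexx x : dle th x x.
Proof. by rewrite /dle eqxx orbT. Qed.

Lemma dle_trans y x z : dle th x y -> dle th y z -> dle th x z.
Proof.
rewrite !dleE => /andP[a1 a2] /andP[b1 b2].
by rewrite (le_trans a1)// (le_trans a2).
Qed.

Lemma dle_anti x y : dle th x y -> dle th y x -> x = y.
Proof.
rewrite !dleE => /andP[a1 a2] /andP[b1 b2].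
case: x y a1 a2 b1 b2 => [x1 x2] [y1 y2]; rewrite /ozc /zsgn /=.
case: th => /= *; congr (_, _); lra.
Qed.

Lemma dlt_le_trans y x z : dlt th x y -> dle th y z -> dlt th x z.
Proof.
rewrite !dltE => /andP[xy nxy] yz; rewrite (dle_trans xy yz)/=.
by apply: contraNneq nxy => xz; apply/eqP/dle_anti => //; rewrite xz.
Qed.

Lemma ditvE x y z : ditv th x y z = (dle th x z /\ dle th z y) :> Prop.
Proof. by rewrite /ditv /=; apply/propext; split => [/andP|[-> ->]]. Qed.

Lemma ditv_sub a b x y : dle th a x -> dle th y b ->
  ditv th x y `<=` ditv th a b.
Proof.
move=> ax yb z; rewrite !ditvE => -[xz zy].
by split; [exact: dle_trans xz|exact: dle_trans yb].
Qed.

Lemma path_dle a s : path (dlt th) a s -> dle th a (last a s).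
Proof.
elim: s a => [|x s IH] a /=; first by rewrite dlexx.
by move=> /andP[/dltW ax /IH]; exact: dle_trans.
Qed.

(** The cell function is left abstract, so that one argument serves lower terms, upper terms and
    increments of a primitive, for either component. *)
Definition csum phi a s : R := \sum_(p <- zip (a :: s) s) phi p.1 p.2.

Lemma csum_nil phi a : csum phi a [::] = 0.
Proof. by rewrite /csum big_nil. Qed.

Lemma csum_cons phi a x s : csum phi a (x :: s) = phi a x + csum phi x s.
Proof. by rewrite /csum /= big_cons. Qed.

Lemma csum_cat phi a s t :
  csum phi a (s ++ t) = csum phi a s + csum phi (last a s) t.
Proof.
elim: s a => [|x s IH] a /=; first by rewrite csum_nil add0r.
by rewrite !csum_cons IH addrA.
Qed.

Lemma csum_telescope G a s :
  csum (fun x y => G y - G x) a s = G (last a s) - G a.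
Proof.
elim: s a => [|x s IH] a; first by rewrite csum_nil /= subrr.
by rewrite csum_cons IH /=; ring.
Qed.

Definition cell_le a b phi psi := forall x y,
  dle th a x -> dlt th x y -> dle th y b -> phi x y <= psi x y.

Lemma cell_leW a b x y phi psi : dle th a x -> dle th y b ->
  cell_le a b phi psi -> cell_le x y phi psi.
Proof.
move=> ax yb H u v xu uv vy.
by apply: H => //; [exact: dle_trans xu|exact: dle_trans yb].
Qed.

Lemma csum_le a b phi psi s : cell_le a b phi psi -> dpartition th a b s ->
  csum phi a s <= csum psi a s.
Proof.
move=> H /andP[+ /eqP ls]; move: H; rewrite -{b}ls.
elim: s a => [|x s IH] a H /=; first by rewrite !csum_nil.
move=> /andP[ax xs]; rewrite !csum_cons lerD//.
  by apply: H => //=; [exact: dlexx|exact: path_dle].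
by apply: IH => //; apply: cell_leW H; [exact: dltW|exact: dlexx].
Qed.

Lemma dpartition_neq0 a b : dle th a b -> dpartition th a b !=set0.
Proof.
rewrite /dle => /orP[ab|/eqP ->]; last first.
  by exists [::]; rewrite /dpartition /= eqxx.
by exists [:: b]; rewrite /dpartition /= ab eqxx.
Qed.

Lemma dpartition_cat a x b s t : dpartition th a x s -> dpartition th x b t ->
  dpartition th a b (s ++ t).
Proof.
move=> /andP[sp /eqP ls] /andP[tp /eqP lt].
by rewrite /dpartition /= cat_path last_cat ls sp tp lt eqxx.
Qed.

Lemma dpartition_xx a : dpartition th a a = [set [::]].
Proof.
apply/seteqP; split => [s|s ->]; last by rewrite /dpartition /= eqxx.
case: s => // x s /= /andP[/= /andP[ax xs] /eqP ls].
have := dlt_le_trans ax (path_dle xs).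
by rewrite ls dltE eqxx andbF.
Qed.

Definition lo phi a b : R := sup [set csum phi a s | s in dpartition th a b].
Definition up psi a b : R := inf [set csum psi a s | s in dpartition th a b].

Lemma lo_xx phi a : lo phi a a = 0.
Proof. by rewrite /lo dpartition_xx image_set1 csum_nil sup1. Qed.

(** The increments of [G] telescope to the same value on every chain. That value lies above all
    lower sums and below all upper sums, so [lo = up] leaves no other choice. *)
Lemma lo_primitive phi psi G a b : dle th a b ->
  cell_le a b phi (fun x y => G y - G x) ->
  cell_le a b (fun x y => G y - G x) psi ->
  lo phi a b = up psi a b -> lo phi a b = G b - G a.
Proof.
move=> ab H1 H2 e; apply/eqP; rewrite eq_le; apply/andP; split.
  apply: ge_sup; first exact/image_nonempty/dpartition_neq0.
  move=> _ [s ps <-]; rewrite (le_trans (csum_le H1 ps))// csum_telescope.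
  by case/andP: ps => _ /eqP ->.
rewrite e; apply: lb_le_inf; first exact/image_nonempty/dpartition_neq0.
move=> _ [s ps <-]; apply: le_trans (csum_le H2 ps); rewrite csum_telescope.
by case/andP: ps => _ /eqP ->.
Qed.

(** * Lower and upper integrals of cell functions *)

Section Darboux.
Variables (phi psi : R * R -> R * R -> R) (G1 G2 : R * R -> R) (a b : R * R).
Hypothesis phi_ge : cell_le a b (fun x y => G1 y - G1 x) phi.
Hypothesis phi_le_psi : cell_le a b phi psi.
Hypothesis psi_le : cell_le a b psi (fun x y => G2 y - G2 x).

(** Telescoping [G2] bounds the sums independently of the chain; without such a bound [sup] would be
    a default value. *)
Lemma has_sup_lo x : dle th a x -> dle th x b ->
  has_sup [set csum phi a s | s in dpartition th a x].
Proof.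
move=> ax xb; split; first exact/image_nonempty/dpartition_neq0.
exists (G2 x - G2 a) => _ [s ps <-].
have aa := dlexx a.
apply: le_trans (csum_le (cell_leW aa xb phi_le_psi) ps) _.
apply: le_trans (csum_le (cell_leW aa xb psi_le) ps) _.
by rewrite csum_telescope; case/andP: ps => _ /eqP ->.
Qed.

Lemma has_inf_up x : dle th a x -> dle th x b ->
  has_inf [set csum psi a s | s in dpartition th a x].
Proof.
move=> ax xb; split; first exact/image_nonempty/dpartition_neq0.
exists (G1 x - G1 a) => _ [s ps <-].
have aa := dlexx a.
apply: le_trans (csum_le (cell_leW aa xb phi_le_psi) ps).
apply: le_trans (csum_le (cell_leW aa xb phi_ge) ps).
by rewrite csum_telescope; case/andP: ps => _ /eqP ->.
Qed.

Lemma lo_ge x s : dle th a x -> dle th x b -> dpartition th a x s ->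
  csum phi a s <= lo phi a x.
Proof.
move=> ax xb ps; apply: ub_le_sup; last by exists s.
by case: (has_sup_lo ax xb).
Qed.

Lemma up_le x s : dle th a x -> dle th x b -> dpartition th a x s ->
  up psi a x <= csum psi a s.
Proof.
move=> ax xb ps; apply: ge_inf; last by exists s.
by case: (has_inf_up ax xb).
Qed.

Lemma lo_eq_up_sub x :
  (forall e : R, 0 < e -> exists2 s, dpartition th a x s &
    csum psi a s - csum phi a s < e) ->
  (forall e : R, 0 < e -> exists2 s, dpartition th x b s &
    csum psi x s - csum phi x s < e) ->
  dle th a x -> dle th x b -> lo phi a b = up psi a b ->
  lo phi a x = up psi a x.
Proof.
move=> fine1 fine2 ax xb e; have ab := dle_trans ax xb.
apply/eqP; rewrite eq_le; apply/andP; split; last first.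
  (* A single chain with nearly equal sums already gives [up <= lo]. *)
  apply/ler_addgt0Pr => d d0; have [s ps sd] := fine1 d d0.
  have := lo_ge ax xb ps; have := up_le ax xb ps; lra.
apply: ge_sup; first exact/image_nonempty/dpartition_neq0.
move=> _ [s ps <-]; apply: lb_le_inf.
  exact/image_nonempty/dpartition_neq0.
(* The chains [s] and [t] may have no common refinement. Followed by the same [u] they run from [a]
   to [b], where [lo = up] separates their sums, and [u] costs less than [d]. *)
move=> _ [t pt <-]; apply/ler_addgt0Pr => d d0; have [u pu ud] := fine2 d d0.
have := lo_ge ab (dlexx b) (dpartition_cat ps pu).
have := up_le ab (dlexx b) (dpartition_cat pt pu).
rewrite !csum_cat; case/andP: ps => _ /eqP ->; case/andP: pt => _ /eqP ->.
lra.
Qed.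

(** Appending the cell to nearly optimal chains ending at [u] bounds the increment of [lo] below and
    that of [up] above; the equalities at [u] and [v] transfer the second bound to [lo]. *)
Lemma lo_increment u v : dle th a u -> dlt th u v -> dle th v b ->
  lo phi a u = up psi a u -> lo phi a v = up psi a v ->
  phi u v <= lo phi a v - lo phi a u <= psi u v.
Proof.
move=> au uv vb eu ev.
have ub := dle_trans (dltW uv) vb; have av := dle_trans au (dltW uv).
have puv : dpartition th u v [:: v] by rewrite /dpartition /= uv eqxx.
apply/andP; split; apply/ler_addgt0Pr => d d0.
  have [_ [s ps <-]] := sup_adherent d0 (has_sup_lo au ub).
  rewrite -/(lo phi a u) => sd.
  have := lo_ge av vb (dpartition_cat ps puv).
  rewrite csum_cat; case/andP: ps => _ /eqP ->.
  rewrite csum_cons csum_nil; lra.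
have [_ [s ps <-]] := inf_adherent d0 (has_inf_up au ub).
rewrite -/(up psi a u) => sd.
have := up_le av vb (dpartition_cat ps puv).
rewrite csum_cat; case/andP: ps => _ /eqP ->.
rewrite csum_cons csum_nil; lra.
Qed.

End Darboux.
End Chains.

(** * Darboux terms of 1-forms, and the integrals of both types in these terms *)

Section Cells.
Variables (R : realType) (th : dual_type).
Implicit Types (x y a b c u v t : R * R) (s : seq (R * R)) (g h G : R * R -> R).
Local Notation zs := (@zsgn R th).
Local Notation oz := (@ozc R th).

(* Darboux terms of the 1-form [h dRe + zsgn * g dZe]; the pair (g, h) is
   (0, f_Re) for the real part of the integral and (f_Re, zsgn * f_Ze) for
   [zsgn] times its Ze part. *)
Definition icell g h x y : R :=
  inf (g @` ditv th x y) * (oz y - oz x) +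
  inf (h @` ditv th x y) * (y.1 - x.1).
Definition scell g h x y : R :=
  sup (g @` ditv th x y) * (oz y - oz x) +
  sup (h @` ditv th x y) * (y.1 - x.1).

Lemma sup_image_opp g (A : set (R * R)) :
  sup ((fun t => - g t) @` A) = - inf (g @` A).
Proof. by rewrite /inf opprK image_comp. Qed.

Lemma inf_image_opp g (A : set (R * R)) :
  inf ((fun t => - g t) @` A) = - sup (g @` A).
Proof.
rewrite /inf image_comp; congr (- sup _).
by apply: eq_imagel => x _ /=; rewrite opprK.
Qed.

(* Also true for empty A, since inf set0 = 0. *)
Lemma inf_image0 (A : set (R * R)) : inf ((fun=> 0 : R) @` A) = 0.
Proof.
have [->|A0] := eqVneq A set0; first by rewrite image_set0 inf0.
by rewrite set_cst (negbTE A0) inf1.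
Qed.

Lemma sup_image0 (A : set (R * R)) : sup ((fun=> 0 : R) @` A) = 0.
Proof.
have [->|A0] := eqVneq A set0; first by rewrite image_set0 sup0.
by rewrite set_cst (negbTE A0) sup1.
Qed.

Lemma zipsum_fst (F : R * R -> R * R -> R * R) a s :
  (\sum_(p <- zip (a :: s) s) F p.1 p.2).1 = csum (fun x y => (F x y).1) a s.
Proof. by rewrite /csum (big_morph fst (id1 := 0) (op1 := +%R)). Qed.

Lemma zipsum_snd (F : R * R -> R * R -> R * R) a s :
  zs * (\sum_(p <- zip (a :: s) s) F p.1 p.2).2 =
  csum (fun x y => zs * (F x y).2) a s.
Proof.
by rewrite /csum (big_morph snd (id1 := 0) (op1 := +%R))// mulr_sumr.
Qed.

(** For type 2 the sign turns the supremum of f_Ze in L_2 into the infimum of -f_Ze, so the mixed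
    sums become ordinary lower sums. *)
Lemma lower_sumE f a s :
  (lower_sum th f a s).1 = csum (icell (fun=> 0) (fun t => (f t).1)) a s /\
  zs * (lower_sum th f a s).2 =
    csum (icell (fun t => (f t).1) (fun t => zs * (f t).2)) a s.
Proof.
rewrite /lower_sum; split.
  refine (etrans (zipsum_fst (fun x y => dmul (inf_Re th f x y, match th with
  | Type1 => inf_Ze th f x y | Type2 => sup_Ze th f x y end) (y - x)) a s) _).
  by apply: eq_bigr => -[x y] _; rewrite /icell /dmul /= inf_image0 mul0r add0r.
refine (etrans (zipsum_snd (fun x y => dmul (inf_Re th f x y, match th with
  | Type1 => inf_Ze th f x y | Type2 => sup_Ze th f x y end) (y - x)) a s) _).
apply: eq_bigr => -[x y] _; rewrite /icell /dmul /=.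
rewrite /inf_Re /inf_Ze /sup_Ze /ozc /zsgn; case: th.
  by under [X in _ = _ + inf X * _]eq_imagel do rewrite mul1r; rewrite !mul1r.
under [X in _ = _ + inf X * _]eq_imagel do rewrite mulN1r.
by rewrite inf_image_opp; ring.
Qed.

Lemma upper_sumE f a s :
  (upper_sum th f a s).1 = csum (scell (fun=> 0) (fun t => (f t).1)) a s /\
  zs * (upper_sum th f a s).2 =
    csum (scell (fun t => (f t).1) (fun t => zs * (f t).2)) a s.
Proof.
rewrite /upper_sum; split.
  refine (etrans (zipsum_fst (fun x y => dmul (sup_Re th f x y, match th with
  | Type1 => sup_Ze th f x y | Type2 => inf_Ze th f x y end) (y - x)) a s) _).
  by apply: eq_bigr => -[x y] _; rewrite /scell /dmul /= sup_image0 mul0r add0r.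
refine (etrans (zipsum_snd (fun x y => dmul (sup_Re th f x y, match th with
  | Type1 => sup_Ze th f x y | Type2 => inf_Ze th f x y end) (y - x)) a s) _).
apply: eq_bigr => -[x y] _; rewrite /scell /dmul /=.
rewrite /sup_Re /inf_Ze /sup_Ze /ozc /zsgn; case: th.
  by under [X in _ = _ + sup X * _]eq_imagel do rewrite mul1r; rewrite !mul1r.
under [X in _ = _ + sup X * _]eq_imagel do rewrite mulN1r.
by rewrite sup_image_opp; ring.
Qed.

(** For type 2 the same sign turns the infimum over partitions of Ze L_2 into a supremum. *)
Lemma lower_integralE f a b :
  (lower_integral th f a b).1 =
    lo th (icell (fun=> 0) (fun t => (f t).1)) a b /\
  zs * (lower_integral th f a b).2 =
    lo th (icell (fun t => (f t).1) (fun t => zs * (f t).2)) a b.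
Proof.
rewrite /lower_integral /lo /=; split.
  congr (sup _); apply: eq_imagel => s _; by case: (lower_sumE f a s).
under [X in _ = sup X]eq_imagel do rewrite -(lower_sumE f a _).2.
rewrite /zsgn; case: th.
  by rewrite mul1r; under [X in _ = sup X]eq_imagel do rewrite mul1r.
rewrite mulN1r /inf opprK image_comp; congr (sup _).
by apply: eq_imagel => s _ /=; rewrite mulN1r.
Qed.

Lemma upper_integralE f a b :
  (upper_integral th f a b).1 =
    up th (scell (fun=> 0) (fun t => (f t).1)) a b /\
  zs * (upper_integral th f a b).2 =
    up th (scell (fun t => (f t).1) (fun t => zs * (f t).2)) a b.
Proof.
rewrite /upper_integral /up /=; split.
  congr (inf _); apply: eq_imagel => s _; by case: (upper_sumE f a s).
under [X in _ = inf X]eq_imagel do rewrite -(upper_sumE f a _).2.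
rewrite /zsgn; case: th.
  by rewrite mul1r; under [X in _ = inf X]eq_imagel do rewrite mul1r.
rewrite mulN1r /inf image_comp; congr (- sup _).
by apply: eq_imagel => s _ /=; rewrite mulN1r opprK.
Qed.

Lemma zsgn_inj : injective ( *%R zs).
Proof.
by apply: mulfI; rewrite /zsgn; case: th; rewrite ?oppr_eq0 oner_eq0.
Qed.

Definition integrable_form g h a b : Prop :=
  lo th (icell g h) a b = up th (scell g h) a b.

Lemma lower_eq_upper_integral f a b :
  lower_integral th f a b = upper_integral th f a b <->
  integrable_form (fun=> 0) (fun t => (f t).1) a b /\
  integrable_form (fun t => (f t).1) (fun t => zs * (f t).2) a b.
Proof.
rewrite /integrable_form.
have [<- <-] := lower_integralE f a b; have [<- <-] := upper_integralE f a b.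
case: lower_integral => l1 l2; case: upper_integral => u1 u2 /=.
by split=> [[-> ->]//|[-> /zsgn_inj ->]].
Qed.

Definition bounded_on g (A : set (R * R)) :=
  exists M, forall x, A x -> `|g x| <= M.

Lemma icell_ge g h x y m1 m2 : dle th x y ->
  (forall t, ditv th x y t -> m1 <= g t) ->
  (forall t, ditv th x y t -> m2 <= h t) ->
  m1 * (oz y - oz x) + m2 * (y.1 - x.1) <= icell g h x y.
Proof.
move=> xy gm hm.
have xx : ditv th x y x by rewrite ditvE; split=> //; exact: dlexx.
move: xy; rewrite dleE => /andP[xy1 xy2].
by apply: lerD; apply: ler_wpM2r; rewrite ?subr_ge0//;
  apply: lb_le_inf => [|_ [t ? <-]];
  [exists (g x); exists x| exact: gm|exists (h x); exists x|exact: hm].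
Qed.

Lemma scell_le g h x y m1 m2 : dle th x y ->
  (forall t, ditv th x y t -> g t <= m1) ->
  (forall t, ditv th x y t -> h t <= m2) ->
  scell g h x y <= m1 * (oz y - oz x) + m2 * (y.1 - x.1).
Proof.
move=> xy gm hm.
have xx : ditv th x y x by rewrite ditvE; split=> //; exact: dlexx.
move: xy; rewrite dleE => /andP[xy1 xy2].
by apply: lerD; apply: ler_wpM2r; rewrite ?subr_ge0//;
  apply: ge_sup => [|_ [t ? <-]];
  [exists (g x); exists x| exact: gm|exists (h x); exists x|exact: hm].
Qed.

(** * Bounded forms *)

Section Bounded.
Variables (g h : R * R -> R) (a b : R * R).
Hypotheses (gb : bounded_on g (ditv th a b)) (hb : bounded_on h (ditv th a b)).

Lemma image_bounds k x y t : bounded_on k (ditv th a b) ->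
  dle th a x -> dle th y b -> ditv th x y t ->
  inf (k @` ditv th x y) <= k t <= sup (k @` ditv th x y).
Proof.
move=> [M kM] ax yb tI; have sub := ditv_sub ax yb.
apply/andP; split.
  apply: ge_inf; last by exists t.
  by exists (- M) => _ [u /sub/kM + <-]; rewrite ler_norml => /andP[].
apply: ub_le_sup; last by exists t.
by exists M => _ [u /sub/kM + <-]; rewrite ler_norml => /andP[].
Qed.

(** Both functions are evaluated at one point [t], as the mean value theorem supplies it; with [t]
    equal to [x] this puts lower terms below upper terms. *)
Lemma cell_at x y t : dle th a x -> dle th y b -> ditv th x y t ->
  icell g h x y <= g t * (oz y - oz x) + h t * (y.1 - x.1) <= scell g h x y.
Proof.
move=> ax yb tI.
have /andP[g1 g2] := image_bounds gb ax yb tI.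
have /andP[h1 h2] := image_bounds hb ax yb tI.
have : dle th x y by move: tI; rewrite ditvE => -[]; exact: dle_trans.
rewrite dleE => /andP[xy1 xy2].
by rewrite !lerD// ler_wpM2r// subr_ge0.
Qed.

Lemma icell_le_scell : cell_le th a b (icell g h) (scell g h).
Proof.
move=> x y ax /dltW xy yb.
have xx : ditv th x y x by rewrite ditvE; split=> //; exact: dlexx.
by have /andP[] := cell_at ax yb xx; exact: le_trans.
Qed.

Lemma cell_primitive_bounds : exists G,
  cell_le th a b (fun x y => - G y - - G x) (icell g h) /\
  cell_le th a b (scell g h) (fun x y => G y - G x).
Proof.
have [[M gM] [N hN]] := (gb, hb).
(* As [M] and [N] bound |g| and |h|, the increments of this linear function dominate the upper
   terms, and their negatives lie below the lower terms. *)
exists (fun x => M * oz x + N * x.1); split => x y ax /dltW xy yb;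
  have sub := ditv_sub ax yb.
  rewrite (_ : _ - _ = - M * (oz y - oz x) + - N * (y.1 - x.1)); last by ring.
  apply: icell_ge => // t /sub;
  by [move=> /gM; rewrite ler_norml => /andP[]
     |move=> /hN; rewrite ler_norml => /andP[]].
rewrite (_ : _ - _ = M * (oz y - oz x) + N * (y.1 - x.1)); last by ring.
apply: scell_le => // t /sub;
by [move=> /gM; rewrite ler_norml => /andP[]
   |move=> /hN; rewrite ler_norml => /andP[]].
Qed.

End Bounded.

(** Distances are taken in Re and [ozc], so that the sides of a cell control them. *)
Definition uniform_on g (A : set (R * R)) := forall e : R, 0 < e ->
  exists2 d : R, 0 < d & forall p q, A p -> A q ->
    `|p.1 - q.1| < d -> `|oz p - oz q| < d -> `|g p - g q| <= e.

Lemma continuous_uniform_on g a b :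
  {within ditv th a b, continuous g} -> uniform_on g (ditv th a b).
Proof.
move=> gc e e0.
have cab : compact (ditv th a b).
  (* The type 2 order reverses Ze, so the second side of the rectangle has its ends swapped. *)
  rewrite [X in compact X](_ : _ =
    `[a.1, b.1] `*` (if th is Type1 then `[a.2, b.2] else `[b.2, a.2])).
    by apply: compact_setX; [|case: th]; exact: segment_compact.
  apply/seteqP; split => x; rewrite ditvE !dleE /ozc /zsgn /=;
    case: th; rewrite /= ?mul1r ?mulN1r ?lerN2 !in_itv /=;
    by move=> [/andP[-> ->] /andP[-> ->]].
have [d d0 H] := compact_uniform_continuous cab gc e0.
exists d => // p q pA qA pq1 pq2; apply/ltW/H => //; split => //=.
by move: pq2; rewrite /ozc -mulrBr normr_zsgnM.
Qed.

Lemma uniform_onZ g (A : set (R * R)) :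
  uniform_on g A -> uniform_on (fun x => zs * g x) A.
Proof.
move=> gu e /gu[d d0 H]; exists d => // p q pA qA pd qd.
by rewrite -mulrBr normr_zsgnM; exact: H.
Qed.

Lemma ditv_dist x y t u : ditv th x y t -> ditv th x y u ->
  `|t.1 - u.1| <= y.1 - x.1 /\ `|oz t - oz u| <= oz y - oz x.
Proof.
rewrite !ditvE !dleE => -[/andP[? ?] /andP[? ?]] [/andP[? ?] /andP[? ?]].
by split; rewrite ler_norml; apply/andP; split; lra.
Qed.

(** * Uniformly continuous forms: fine chains and the derivative of the integral *)

Section Uniform.
Variables (g h : R * R -> R) (a b : R * R).
Hypotheses (gu : uniform_on g (ditv th a b)) (hu : uniform_on h (ditv th a b)).

Lemma uniform_both e : 0 < e -> exists2 d, 0 < d & forall p q,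
  ditv th a b p -> ditv th a b q -> `|p.1 - q.1| < d -> `|oz p - oz q| < d ->
  `|g p - g q| <= e /\ `|h p - h q| <= e.
Proof.
move=> e0; have [d d0 dg] := gu e0; have [d' d'0 dh] := hu e0.
exists (Num.min d d'); first by rewrite lt_min d0.
by move=> p q pA qA; rewrite !lt_min => /andP[? ?] /andP[? ?]; split;
    [exact: dg|exact: dh].
Qed.

(** Each extremum moves by at most [e] from the value at [u], and the sides are nonnegative. The
    error is [e] times the half-perimeter, which is additive along chains. *)
Lemma cell_near x y u e : dle th x y -> ditv th x y u ->
  (forall t, ditv th x y t -> `|g t - g u| <= e /\ `|h t - h u| <= e) ->
  (g u * (oz y - oz x) + h u * (y.1 - x.1)) -
    e * (oz y - oz x + (y.1 - x.1)) <= icell g h x y /\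
  scell g h x y <= (g u * (oz y - oz x) + h u * (y.1 - x.1)) +
    e * (oz y - oz x + (y.1 - x.1)).
Proof.
move=> xy uI H; split.
  rewrite (_ : _ - _ = (g u - e) * (oz y - oz x) + (h u - e) * (y.1 - x.1));
    last by ring.
  apply: icell_ge => // t /H [];
  by rewrite !ler_norml => /andP[? ?] /andP[? ?]; lra.
rewrite (_ : _ + e * _ = (g u + e) * (oz y - oz x) + (h u + e) * (y.1 - x.1));
  last by ring.
apply: scell_le => // t /H [];
by rewrite !ler_norml => /andP[? ?] /andP[? ?]; lra.
Qed.

(** The diagonal is halved until the cells are so small that [g] and [h] vary by at most [k]; the
    half-perimeter [S] being additive, the gaps sum to at most [2 * k * S x y]. *)
Lemma fine_partition x y e : dle th a x -> dle th x y -> dle th y b -> 0 < e ->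
  exists2 s, dpartition th x y s &
    csum (scell g h) x s - csum (icell g h) x s < e.
Proof.
move=> ax xy yb e0.
set S := fun x y : R * R => oz y - oz x + (y.1 - x.1).
have S0 : 0 <= S x y.
  by move: xy; rewrite dleE /S => /andP[? ?]; lra.
(* Then [2 * k * S x y] is [e * (S x y / (S x y + 1))], below [e]; the 1 avoids division by zero
   when [x = y]. *)
pose k := e / (2 * (S x y + 1)).
have k0 : 0 < k by rewrite divr_gt0// mulr_gt0// ltr_wpDl.
have [d d0 dgh] := uniform_both k0.
suff halving n u v : dle th a u -> dle th u v -> dle th v b ->
    S u v < d * 2 ^+ n -> exists2 s, dpartition th u v s &
    csum (scell g h) u s - csum (icell g h) u s <= 2 * k * S u v.
  have [n nS] : exists n : nat, S x y < d * 2 ^+ n.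
    (* The Archimedean bound [n] exceeds [S x y / d], and [n < 2 ^ n]. *)
    exists (Num.bound (S x y / d)); rewrite mulrC -ltr_pdivrMr//.
    have /lt_le_trans := archi_boundP (divr_ge0 S0 (ltW d0)); apply.
    by rewrite -natrX ler_nat ltnW// ltn_expl.
  have [s ps sS] := halving n x y ax xy yb nS; exists s => //.
  apply: le_lt_trans sS _; rewrite /k.
  rewrite (_ : _ * _ = e * (S x y / (S x y + 1))); last by field; lra.
  by rewrite gtr_pMr// ltr_pdivrMr; lra.
elim: n u v => [|n IH] u v au uv vb; last first.
  rewrite exprS => nS.
  pose m : R * R := ((u.1 + v.1) / 2, (u.2 + v.2) / 2).
  have mz : oz m = (oz u + oz v) / 2 by rewrite /ozc /m /=; ring.
  have [um mv] : dle th u m /\ dle th m v.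
    move: uv; rewrite !dleE mz /m /= => /andP[? ?].
    by split; apply/andP; split; lra.
  have [Sum Smv] : S u m = S u v / 2 /\ S m v = S u v / 2.
    by rewrite /S mz /m /=; split; field.
  have [||s ps sS] := IH u m au um; [exact: dle_trans vb|by rewrite Sum; lra|].
  have [||t pt tS] := IH m v _ mv vb; [exact: dle_trans um|by rewrite Smv; lra|].
  exists (s ++ t); first exact: dpartition_cat ps pt.
  rewrite !csum_cat; case/andP: ps => _ /eqP ->.
  by rewrite Sum in sS; rewrite Smv in tS; lra.
rewrite expr0 mulr1 => Sd.
(* Chains are strict, so a degenerate cell is covered by the empty chain. *)
have [<-|nuv] := eqVneq u v.
  exists [::]; first by rewrite dpartition_xx.
  by rewrite !csum_nil /S; lra.
exists [:: v]; first by rewrite /dpartition /= dltE uv nuv eqxx.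
rewrite !csum_cons !csum_nil !addr0.
have uI : ditv th u v u by rewrite ditvE; split => //; exact: dlexx.
have [] := @cell_near u v u k uv uI; last by rewrite /S; lra.
move=> t tI; have sub := ditv_sub au vb.
have [? ?] := ditv_dist tI uI.
by move: uv Sd; rewrite dleE /S => /andP[? ?] ?; apply: dgh; try exact: sub; lra.
Qed.

Hypotheses (gb : bounded_on g (ditv th a b)) (hb : bounded_on h (ditv th a b)).
Hypothesis ghab : integrable_form g h a b.

Lemma integrable_form_sub x : ditv th a b x -> integrable_form g h a x.
Proof.
rewrite ditvE => -[ax xb]; have [G [G1 G2]] := cell_primitive_bounds gb hb.
apply: (lo_eq_up_sub G1 (icell_le_scell gb hb) G2) => // e e0.
  by apply: fine_partition => //; exact: dlexx.
by apply: fine_partition => //; exact: dlexx.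
Qed.

(** Comparable [x] and [c] are the ends of a cell, so the increment of [lo] lies between the two
    Darboux terms of that cell, both close to the value of the form at [c]. *)
Lemma lo_tderiv c e : ditv th a b c -> 0 < e -> exists2 d, 0 < d &
  forall x, ditv th a b x -> dle th c x || dle th x c ->
    `|x.1 - c.1| < d -> `|oz x - oz c| < d ->
    `|lo th (icell g h) a x - lo th (icell g h) a c -
      (g c * (oz x - oz c) + h c * (x.1 - c.1))| <=
    e * (`|oz x - oz c| + `|x.1 - c.1|).
Proof.
move=> cI e0; have [d d0 dgh] := uniform_both e0; exists d => // x xI cmp.
have [G [G1 G2]] := cell_primitive_bounds gb hb.
(* The base point [w] is kept apart from the ends because [c] is the lower end when [x] is above it
   and the upper end when [x] is below. *)
have key u v w : ditv th a b u -> ditv th a b v -> dlt th u v ->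
    ditv th u v w -> ditv th a b w -> v.1 - u.1 < d -> oz v - oz u < d ->
    `|lo th (icell g h) a v - lo th (icell g h) a u -
      (g w * (oz v - oz u) + h w * (v.1 - u.1))| <=
    e * ((oz v - oz u) + (v.1 - u.1)).
  move=> uI vI uv wI wI' d1 d2; move: (uI) (vI).
  rewrite !ditvE => -[au ub] [av vb].
  have /andP[L U] := lo_increment G1 (icell_le_scell gb hb) G2 au uv vb
    (integrable_form_sub uI) (integrable_form_sub vI).
  have [|] := @cell_near u v w e (dltW uv) wI; last first.
    by rewrite ler_norml => ? ?; apply/andP; split; lra.
  move=> t tI; have [? ?] := ditv_dist tI wI.
  by apply: dgh => //; [exact: (ditv_sub au vb tI)|lra|lra].
move=> d1 d2.
have [->|nxc] := eqVneq x c.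
  by rewrite !subrr !mulr0 !addr0 subr0 !normr0 addr0 mulr0.
case/orP: cmp => [cx|xc].
  have cxc : ditv th c x c by rewrite ditvE; split => //; exact: dlexx.
  have := key c x c cI xI; rewrite dltE cx eq_sym nxc => /(_ isT cxc cI) K.
  move: cx; rewrite dleE -[c.1 <= _]subr_ge0 -[oz c <= _]subr_ge0 =>
    /andP[/ger0_norm n1 /ger0_norm n2].
  by rewrite n1 n2 in d1 d2 *; exact: K.
have xcc : ditv th x c c by rewrite ditvE; split => //; exact: dlexx.
have := key x c c xI cI; rewrite dltE xc nxc => /(_ isT xcc cI) K.
move: xc; rewrite dleE -[x.1 <= _]subr_ge0 -[oz x <= _]subr_ge0 =>
  /andP[/ger0_norm n1 /ger0_norm n2].
rewrite (distrC x.1) n1 in d1 *; rewrite (distrC (oz x)) n2 in d2 *.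
rewrite -normrN; rewrite (_ : - (_ - _ - _) =
  lo th (icell g h) a c - lo th (icell g h) a x -
      (g c * (oz c - oz x) + h c * (c.1 - x.1))); last by ring.
exact: K.
Qed.

End Uniform.

(** * Forms that have a primitive *)

Section Primitive.
Variables (g h G : R * R -> R) (a b : R * R).
Hypotheses (gb : bounded_on g (ditv th a b)) (hb : bounded_on h (ditv th a b)).
Hypothesis dG : forall c, ditv th a b c -> forall e : R, 0 < e ->
  exists2 d : R, 0 < d & forall x, ditv th a b x ->
    `|x.1 - c.1| + `|oz x - oz c| < d ->
    `|G x - G c - (g c * (oz x - oz c) + h c * (x.1 - c.1))| <=
    e * (`|x.1 - c.1| + `|oz x - oz c|).

(** The segment from [x] to [y] is monotone in both coordinates and so stays in the cell; along it
    [G] has as derivative the form evaluated on [y - x]. *)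
Lemma mean_value_cell x y : dle th a x -> dle th x y -> dle th y b ->
  exists2 t, ditv th x y t &
    G y - G x = g t * (oz y - oz x) + h t * (y.1 - x.1).
Proof.
move=> ax xy yb; have sub := ditv_sub ax yb.
pose l r : R * R := (x.1 + r * (y.1 - x.1), x.2 + r * (y.2 - x.2)).
have l2 r : oz (l r) = oz x + r * (oz y - oz x) by rewrite /ozc /l /=; ring.
have lI r : 0 <= r <= 1 -> ditv th x y (l r).
  move=> /andP[r0 r1]; move: xy; rewrite ditvE !dleE l2 /= => /andP[? ?].
  by split; apply/andP; split; nra.
have l0 : l 0 = x by rewrite /l !mul0r !addr0; case: (x).
have l1 : l 1 = y by rewrite /l !mul1r !subrKC; case: (y).
(* [W] converts parameter distances into distances along the segment; the 1 keeps it positive when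
   [x = y]. *)
pose W := `|y.1 - x.1| + `|oz y - oz x| + 1.
have W0 : 0 < W by rewrite ltr_wpDl// addr_ge0.
have [|r r01 e] := @mean_value_unit_itv R (G \o l)
  (fun r => g (l r) * (oz y - oz x) + h (l r) * (y.1 - x.1)); last first.
  by exists (l r); [exact: lI|move: e; rewrite /= l0 l1].
move=> c c01 e e0.
have eW : 0 < e / W by rewrite divr_gt0.
have [d d0 H] := dG (sub _ (lI c c01)) eW.
exists (d / W); first by rewrite divr_gt0.
move=> r r01; rewrite ltr_pdivlMr// => rd.
have e1 : (l r).1 - (l c).1 = (r - c) * (y.1 - x.1) by rewrite /l /=; ring.
have e2 : oz (l r) - oz (l c) = (r - c) * (oz y - oz x) by rewrite !l2; ring.
have rcW : `|r - c| * (`|y.1 - x.1| + `|oz y - oz x|) <= `|r - c| * W.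
  by rewrite ler_wpM2l// /W lerDl.
have := H _ (sub _ (lI r r01)); rewrite e1 e2 !normrM -mulrDr.
move=> /(_ (le_lt_trans rcW rd)) /= h1.
rewrite (_ : (_ + _) * (r - c) = g (l c) * ((r - c) * (oz y - oz x)) +
  h (l c) * ((r - c) * (y.1 - x.1))); last by ring.
apply: le_trans h1 _; apply: le_trans (ler_wpM2l (ltW eW) rcW) _.
by rewrite mulrCA divfK ?gt_eqF// mulrC.
Qed.

Lemma lo_form_primitive : dle th a b -> integrable_form g h a b ->
  lo th (icell g h) a b = G b - G a.
Proof.
move=> ab; apply: lo_primitive => // x y ax /dltW xy yb;
have [t tI ->] := mean_value_cell ax xy yb;
by have /andP[] := cell_at gb hb ax yb tI.
Qed.

End Primitive.
End Cells.

(** * Return to dual-valued functions, the norm and the two derivatives *)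

Section DualIntegral.
Variables (R : realType) (th : dual_type).
Implicit Types (x y a b c : R * R) (f : R * R -> R * R).
Local Notation zs := (@zsgn R th).
Local Notation oz := (@ozc R th).

(** The convention for equal ends agrees with [lo], since the empty chain is then the only one. *)
Lemma dintegralE f a b :
  (dintegral th f a b).1 =
    lo th (icell th (fun=> 0) (fun t => (f t).1)) a b /\
  zs * (dintegral th f a b).2 =
    lo th (icell th (fun t => (f t).1) (fun t => zs * (f t).2)) a b.
Proof.
rewrite /dintegral; have [<-|_] := eqVneq a b; last exact: lower_integralE.
by rewrite !lo_xx mulr0.
Qed.

Lemma normr_ozB x c : `|oz x - oz c| = `|x.2 - c.2|.
Proof. by rewrite /ozc -mulrBr normr_zsgnM. Qed.

Lemma dnorm_ge x : `|x.1| <= dnorm x /\ `|x.2| <= dnorm x.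
Proof.
have := sqr_ge0 x.1; have := sqr_ge0 x.2 => h2 h1.
by rewrite -!sqrtr_sqr /dnorm; split; apply: ler_wsqrtr; lra.
Qed.

Lemma dnorm_le x : dnorm x <= 2 * `|x.1| + `|x.2|.
Proof.
have n1 := normr_ge0 x.1; have n2 := normr_ge0 x.2.
have s0 : 0 <= 2 * `|x.1| + `|x.2| by lra.
rewrite -(ger0_norm s0) -sqrtr_sqr /dnorm; apply: ler_wsqrtr.
rewrite -(real_normK (num_real x.1)) -(real_normK (num_real x.2)).
nra.
Qed.

Lemma dnorm_gt0 x : x != 0 -> 0 < dnorm x.
Proof.
have [h1 h2] := dnorm_ge x; apply: contraNT; rewrite -leNgt => x0.
case: x => [x1 x2] /= in h1 h2 x0 *.
apply/eqP; congr (_, _); apply/normr0_eq0/le_anti;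
  by rewrite normr_ge0 (le_trans _ x0).
Qed.

Lemma dbounded_on f (A : set (R * R)) : dbounded f A ->
  bounded_on (fun t => (f t).1) A /\ bounded_on (fun t => zs * (f t).2) A.
Proof.
(* [bounded] provides bounds only strictly above [M] and [N], hence the added 1. *)
move=> [[M [_ HM]] [N [_ HN]]]; split; [exists (M + 1)|exists (N + 1)] => x Ax.
  by apply: HM => //; rewrite ltrDl.
by rewrite normr_zsgnM; apply: HN => //; rewrite ltrDl.
Qed.

Lemma dboundedW f (A B : set (R * R)) :
  A `<=` B -> dbounded f B -> dbounded f A.
Proof.
by move=> AB [b1 b2]; split; [apply: filterS b1|apply: filterS b2] => M H x /AB;
  exact: H.
Qed.

Lemma bounded_on0 (A : set (R * R)) : bounded_on (fun=> 0 : R) A.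
Proof. by exists 0 => x _; rewrite normr0. Qed.

Lemma uniform_on0 (A : set (R * R)) : uniform_on th (fun=> 0 : R) A.
Proof.
by move=> e e0; exists 1 => // p q *; rewrite subrr normr0 ltW.
Qed.

Section Continuous.
Variables (f : R * R -> R * R) (a b : R * R).
Hypotheses (f1 : {within ditv th a b, continuous (fun x => (f x).1)})
           (f2 : {within ditv th a b, continuous (fun x => (f x).2)}).
Hypothesis fI : dintegrable th f a b.

Lemma dintegrable_sub x : ditv th a b x -> dintegrable th f a x.
Proof.
move=> xI; have [fb /lower_eq_upper_integral[I1 I2]] := fI.
have [b1 b2] := dbounded_on fb.
have u1 := continuous_uniform_on f1.
have u2 := uniform_onZ (continuous_uniform_on f2).
split.
  apply: dboundedW fb; apply: ditv_sub; first exact: dlexx.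
  by move: xI; rewrite ditvE => -[].
apply/lower_eq_upper_integral; split.
  exact: (integrable_form_sub (@uniform_on0 _) u1 (@bounded_on0 _) b1 I1 xI).
exact: (integrable_form_sub u1 u2 b1 b2 I2 xI).
Qed.

Lemma dintegral_tderiv c : ditv th a b c ->
  is_tderiv th (ditv th a b) (fun x => dintegral th f a x) c (f c).
Proof.
move=> cI eps eps0; have [fb /lower_eq_upper_integral[I1 I2]] := fI.
have [b1 b2] := dbounded_on fb.
have u1 := continuous_uniform_on f1.
have u2 := uniform_onZ (continuous_uniform_on f2).
(* Each component of the error is at most [eps / 7] times twice the norm of [x - c], and [dnorm_le]
   weights the components by 2 and 1: the total is 6/7 of [eps], strictly below it. *)
have e0 : 0 < eps / 7 by rewrite divr_gt0.
have [d d0 H] := lo_tderiv (@uniform_on0 _) u1 (@bounded_on0 _) b1 I1 cI e0.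
have [d' d'0 H'] := lo_tderiv u1 u2 b1 b2 I2 cI e0.
exists (Num.min d d'); first by rewrite lt_min d0.
move=> x [[[xN /eqP xc] cmp] xI].
have /andP[xd xd'] : (dnorm (x - c) < d) && (dnorm (x - c) < d').
  by rewrite -lt_min.
have N0 : 0 < dnorm (x - c) by rewrite dnorm_gt0// subr_eq0.
have [n1 n2] := dnorm_ge (x - c); rewrite /= in n1 n2.
rewrite -normr_ozB in n2.
have := H x xI cmp (le_lt_trans n1 xd) (le_lt_trans n2 xd).
have := H' x xI cmp (le_lt_trans n1 xd') (le_lt_trans n2 xd').
have [<- <-] := dintegralE f a x; have [<- <-] := dintegralE f a c.
set z := _ - _ - dmul _ _ => h2 h1.
have {}h1 : `|z.1| <= eps / 7 * (`|oz x - oz c| + `|x.1 - c.1|).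
  by move: h1; rewrite mul0r add0r.
have {}h2 : `|z.2| <= eps / 7 * (`|oz x - oz c| + `|x.1 - c.1|).
  rewrite -(normr_zsgnM th); apply: le_trans h2; rewrite le_eqVlt; apply/orP.
  left; apply/eqP; congr (`|_|); rewrite /z /dmul /ozc /=; ring.
have hN : eps / 7 * (`|oz x - oz c| + `|x.1 - c.1|) <=
            eps / 7 * (2 * dnorm (x - c)).
  by rewrite ler_wpM2l ?(ltW e0)//; lra.
have := dnorm_le z; rewrite ltr_pdivrMr// => hz.
have := mulr_gt0 eps0 N0; lra.
Qed.

End Continuous.

(** Clearing the denominator admits [x = c], and the coordinate distance is the one in which the
    mean value argument is phrased. *)
Lemma dderiv_dist (A : set (R * R)) f c L : is_dderiv A f c L ->
  forall e : R, 0 < e -> exists2 d : R, 0 < d & forall x, A x ->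
    `|x.1 - c.1| + `|oz x - oz c| < d ->
    dnorm (f x - f c - dmul L (x - c)) <= e * (`|x.1 - c.1| + `|oz x - oz c|).
Proof.
(* Both halvings, of [e] and of [d], absorb the factor 2 between [dnorm] and the coordinate
   distance. *)
move=> fL e e0; have e20 : 0 < e / 2 by rewrite divr_gt0.
have [d d0 H] := fL _ e20; exists (d / 2); first by rewrite divr_gt0.
move=> x Ax; rewrite normr_ozB => xd.
have [->|xc] := eqVneq x c.
  rewrite !subrr normr0 addr0 mulr0 /dmul /= !mulr0 addr0 subr0.
  by rewrite /dnorm /= expr0n /= mulr0 addr0 sqrtr0.
have N0 : 0 < dnorm (x - c) by rewrite dnorm_gt0// subr_eq0.
have := dnorm_le (x - c); rewrite /= => hn.
have n1 := normr_ge0 (x.1 - c.1); have n2 := normr_ge0 (x.2 - c.2).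
have xN : dnorm (x - c) < d by lra.
have /H : (dnbhs_punct c d `&` A) x by split => //; split; [|exact/eqP].
rewrite ltr_pdivrMr// => /ltW /le_trans; apply.
by rewrite -mulrA ler_pM2l//; lra.
Qed.

Lemma dintegral_dderiv f f' a b : dle th a b ->
  (forall c, ditv th a b c -> is_dderiv (ditv th a b) f c (f' c)) ->
  dintegrable th f' a b -> dintegral th f' a b = f b - f a.
Proof.
move=> ab df [fb /lower_eq_upper_integral[I1 I2]].
have [b1 b2] := dbounded_on fb.
have [E1 E2] := dintegralE f' a b.
suff [e1 e2] : (dintegral th f' a b).1 = (f b - f a).1 /\
    zs * (dintegral th f' a b).2 = zs * (f b - f a).2.
  move: e1 e2; case: dintegral => u1 u2; case: (f b - f a) => v1 v2 /=.
  by move=> -> /zsgn_inj ->.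
split.
  (* Each component of the error of [f] is, up to sign, the error of that component as a primitive
     of the matching 1-form, and [dnorm] dominates it. *)
  rewrite E1; apply: (lo_form_primitive (G := fun t => (f t).1)
    (@bounded_on0 _) b1) => // c cI e e0.
  have [d d0 H] := dderiv_dist (df c cI) e0; exists d => // x xI xd.
  apply: le_trans (H x xI xd); set z := (_ - dmul _ _).
  by have [+ _] := dnorm_ge z; rewrite mul0r add0r.
rewrite E2 mulrBr; apply: (lo_form_primitive (G := fun t => zs * (f t).2)
  b1 b2) => // c cI e e0.
have [d d0 H] := dderiv_dist (df c cI) e0; exists d => // x xI xd.
apply: le_trans (H x xI xd); set z := (_ - dmul _ _).
have [_] := dnorm_ge z; rewrite -(normr_zsgnM th).
by congr (`|_| <= _); rewrite /z /dmul /ozc /=; ring.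
Qed.

End DualIntegral.

Unset Implicit Arguments.

Theorem proposition3p3 (R : realType) (theta : dual_type) (a b : R * R)
    (hab : dlt theta a b) :
  (forall f : R * R -> R * R,
     {within ditv theta a b, continuous (fun x => (f x).1)} ->
     {within ditv theta a b, continuous (fun x => (f x).2)} ->
     dintegrable theta f a b ->
     (forall x : R * R, ditv theta a b x -> dlt theta a x ->
        dintegrable theta f a x) /\
     (forall c : R * R, ditv theta a b c ->
        is_tderiv theta (ditv theta a b)
          (fun x => dintegral theta f a x) c (f c)))
  /\
  (forall f f' : R * R -> R * R,
     (forall c : R * R, ditv theta a b c ->
        is_dderiv (ditv theta a b) f c (f' c)) ->
     dintegrable theta f' a b ->
     dintegral theta f' a b = f b - f a).
Proof.
split=> [f f1 f2 fI|f f' df f'I]; last first.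
  by apply: dintegral_dderiv => //; exact: dltW.
split=> [x xI _|c cI]; first exact: (dintegrable_sub f1 f2 fI).
exact: (dintegral_tderiv f1 f2 fI).
Qed.
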